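(* Let $H$ be a finite-dimensional Hopf algebra over a field $k$ with finite exponent $e$, and let $1\leq n<e$. Then (1) $T_n(H)=T_{e-n}(H^{\mathrm{op}})$. (2) $\exp(H^{\mathrm{op}})=\exp(H)$. (3) If $H$ is a $*$-Hopf algebra, then $T_n(H)$ and $T_{e-n}(H)$ correspond to each other under the involution of $H$, i.e. $(T_n(H))^*=T_{e-n}(H)$. (4) If $H$ is a $*$-Hopf algebra, or isomorphic to its opposite Hopf algebra $H^{\mathrm{op}}$, then $t_n(H)=t_{e-n}(H)$ and $t_{m,n}(H)=t_{e-m,e-n}(H)$ for $1\leq m,n<e$.
   Context: For a Hopf algebra $H$ over a field $k$ (with counit $\varepsilon$ and Sweedler notation $\Delta(h)=h_{(1)}\otimes h_{(2)}$) and a positive integer $n$, the $n$-th Hopf power of $h\in H$ is $h^{[n]}=h_{(1)}h_{(2)}\cdots h_{(n)}$ (the $n$-th convolution power of the identity, evaluated at $h$); it is trivial if $h^{[n]}=\varepsilon(h)1$. The exponent $\exp(H)$ is the least positive integer $n$ such that the $n$-th Hopf power of every element of $H$ is trivial. Set $T_n(H)=\{h\in H: h^{[n]}=\varepsilon(h)1\}$, a linear subspace of $H$, $t_n(H)=\dim T_n(H)$, and $t_{m,n}(H)=\dim\bigl(T_m(H)\cap T_n(H)\bigr)$. $H^{\mathrm{op}}$ denotes the opposite Hopf algebra: the same coalgebra with the opposite multiplication. If $k$ is a field with an involution $x\mapsto\overline{x}$, a $*$-Hopf algebra over $k$ is a Hopf algebra $H$ with a semilinear involution $*\colon H\to H$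 on the algebra $H$ (so $(xy)^*=y^*x^*$, $(x^* )^*=x$, $(\lambda x)^*=\overline{\lambda}x^*$) such that $\Delta\colon H\to H\otimes H$ and $\varepsilon\colon H\to k$ are homomorphisms of $*$-algebras. *)

(* Defs.v *)
From HB Require Import structures.
From mathcomp Require Import all_boot all_order all_algebra all_field.

Set Implicit Arguments.
Unset Strict Implicit.
Unset Printing Implicit Defensive.

Import GRing.Theory.
Local Open Scope ring_scope.

Reserved Notation "u ⊗ v" (at level 40, left associativity).

(* The tensor product of two finite-dimensional spaces, in coordinates: the  *)
(* (i, j) entry is the coefficient of e_i ⊗ f_j for the bases e, f below.    *)
(* Lemmas tlift_tens and tens_linear_ext give the universal property.        *)
Definition tensor (k : fieldType) (U V : vectType k) :=
  'M[k]_(\dim {:U}, \dim {:V}).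

HB.instance Definition _ (k : fieldType) (U V : vectType k) :=
  Vector.copy (tensor U V) 'M[k]_(\dim {:U}, \dim {:V}).

Definition tens (k : fieldType) (U V : vectType k) (u : U) (v : V) :
  tensor U V :=
  \matrix_(i, j) (coord (vbasis fullv) i u * coord (vbasis fullv) j v).

Notation "u ⊗ v" := (tens u v) : ring_scope.

(* The linear map on U ⊗ V induced by a bilinear B; in Sweedler notation,    *)
(* tlift B (Δ h) is B(h_(1), h_(2)).                                         *)
Definition tlift (k : fieldType) (U V : vectType k) (W : lmodType k)
    (B : U -> V -> W) (t : tensor U V) : W :=
  \sum_i \sum_j (t : 'M[k]_(_, _)) i j *:
    B (vbasis fullv)`_i (vbasis fullv)`_j.

Definition bilin (k : fieldType) (U V W : lmodType k) (B : U -> V -> W) :=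
  (forall v, linear (B^~ v)) /\ (forall u, linear (B u)).

Section TensorTheory.
Variable k : fieldType.
Implicit Types U V : vectType k.

Fact tlift_is_linear U V (W : lmodType k) (B : U -> V -> W) :
  linear (tlift B).
Proof.
move=> a t s; rewrite /tlift scaler_sumr -big_split /=; apply: eq_bigr => i _.
rewrite scaler_sumr -big_split /=; apply: eq_bigr => j _.
by rewrite !mxE scalerDl scalerA.
Qed.

Lemma tlift_comb U V (W : lmodType k) a (B B1 B2 : U -> V -> W) t :
  (forall u v, B u v = a *: B1 u v + B2 u v) ->
  tlift B t = a *: tlift B1 t + tlift B2 t.
Proof.
move=> BE; rewrite /tlift scaler_sumr -big_split /=; apply: eq_bigr => i _.
rewrite scaler_sumr -big_split /=; apply: eq_bigr => j _.
by rewrite BE scalerDr !scalerA mulrC.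
Qed.

HB.instance Definition _ U V (W : lmodType k) (B : U -> V -> W) :=
  GRing.isLinear.Build k (tensor U V) W _ (tlift B) (tlift_is_linear B).

Lemma tlift_tens U V (W : lmodType k) (B : U -> V -> W) u v :
  bilin B -> tlift B (u ⊗ v) = B u v.
Proof.
case=> Bl Br; rewrite {2}(coord_vbasis (memvf u)) {2}(coord_vbasis (memvf v)).
pose fl w : {linear U -> W} := HB.pack (B^~ w) (GRing.isLinear.Build _ _ _ _ _ (Bl w)).
pose fr w : {linear V -> W} := HB.pack (B w) (GRing.isLinear.Build _ _ _ _ _ (Br w)).
set x := \sum_(i < _) _; set y := \sum_(i < _) _.
rewrite -[B x y]/(fl y x) linear_sum /tlift; apply: eq_bigr => i _.
rewrite linearZ /= -[B _ y]/(fr _ y) linear_sum scaler_sumr.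
by apply: eq_bigr => j _; rewrite linearZ /= mxE scalerA.
Qed.

Lemma tens_bilin U V : bilin (@tens k U V).
Proof.
split=> [v | u] a x y; apply/matrixP => i j; rewrite !mxE linearP /=.
  by rewrite mulrDl mulrA.
by rewrite mulrDr mulrCA.
Qed.

Lemma tlift_id U V (t : tensor U V) : tlift (@tens k U V) t = t.
Proof.
have cb (W : vectType k) (i j : 'I_(\dim {:W})) :
    coord (vbasis {:W}) i (vbasis {:W})`_j = (i == j)%:R.
  by rewrite coord_free ?(basis_free (vbasisP _)) // eq_sym.
apply/matrixP => i j; rewrite /tlift summxE (bigD1 i) //= summxE (bigD1 j) //=.
rewrite !mxE !cb !eqxx !mulr1 !big1 ?addr0 // => [i' ii'|j' jj'].
  rewrite summxE big1 // => j' _; rewrite !mxE !cb eq_sym (negPf ii').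
  by rewrite mul0r mulr0.
by rewrite !mxE !cb [j == _]eq_sym (negPf jj') !mulr0.
Qed.

Lemma tens_ind U V (P : tensor U V -> Prop) :
  (forall u v, P (u ⊗ v)) -> (forall t s, P t -> P s -> P (t + s)) ->
  forall t, P t.
Proof.
move=> P1 PD t; have P0 : P 0.
  by have := P1 0 0; congr P; apply/matrixP => i j; rewrite !mxE linear0 mul0r.
rewrite -(tlift_id t) /tlift; elim/big_ind: _ => // i _.
elim/big_ind: _ => // j _; set c := _ i j.
have := P1 (c *: (vbasis fullv)`_i) (vbasis fullv)`_j; congr P.
by apply/matrixP => i' j'; rewrite !mxE linearZ /= mulrA.
Qed.

Lemma tens_linear_ext U V (W : lmodType k) (f g : {linear tensor U V -> W}) :
  (forall u v, f (u ⊗ v) = g (u ⊗ v)) -> f =1 g.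
Proof. by move=> fg; elim/tens_ind => // t s ft fs; rewrite !linearD ft fs. Qed.

End TensorTheory.

Section TensorMaps.
Variable k : fieldType.

Definition tmap (U V U' V' : vectType k) (f : U -> U') (g : V -> V') :
  tensor U V -> tensor U' V' := tlift (fun u v => f u ⊗ g v).

Definition tassoc (U V W : vectType k) :
  tensor (tensor U V) W -> tensor U (tensor V W) :=
  tlift (fun uv w => tlift (fun u v => u ⊗ (v ⊗ w)) uv).

Lemma tmap_tens (U V U' V' : vectType k)
    (f : {linear U -> U'}) (g : {linear V -> V'}) u v :
  tmap f g (u ⊗ v) = f u ⊗ g v.
Proof.
have [tl tr] := tens_bilin U' V'.
by rewrite /tmap tlift_tens //; split=> [w|w] a x y; rewrite linearP ?tl ?tr.
Qed.

Lemma tassoc_tens (U V W : vectType k) (u : U) (v : V) (w : W) :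
  tassoc (u ⊗ v ⊗ w) = u ⊗ (v ⊗ w).
Proof.
have [tl tr] := tens_bilin U (tensor V W); have [tl' tr'] := tens_bilin V W.
rewrite /tassoc tlift_tens; first rewrite tlift_tens //; split.
- by move=> y a x x'; rewrite tl.
- by move=> x a y y'; rewrite tl' tr.
- by move=> y a x x'; rewrite linearP.
by move=> x a y y'; apply: tlift_comb => u' v'; rewrite tr' tr.
Qed.

(* The extension of star ⊗ star to a map semilinear with respect to bar. *)
Definition tstar (bar : k -> k) (U V : vectType k) (su : U -> U) (sv : V -> V)
    (t : tensor U V) : tensor U V :=
  \sum_i \sum_j bar ((t : 'M[k]_(_, _)) i j) *:
    (su (vbasis fullv)`_i ⊗ sv (vbasis fullv)`_j).

Lemma tstar_tens (bar : {rmorphism k -> k}) (U V : vectType k)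
    (su : U -> U) (sv : V -> V) u v :
  {morph su : x y / x + y} -> (forall a x, su (a *: x) = bar a *: su x) ->
  {morph sv : x y / x + y} -> (forall a x, sv (a *: x) = bar a *: sv x) ->
  tstar bar su sv (u ⊗ v) = su u ⊗ sv v.
Proof.
move=> suD suZ svD svZ; have [tl tr] := tens_bilin U V.
have su0 : su 0 = 0 by have := suZ 0 0; rewrite rmorph0 !scale0r.
have sv0 : sv 0 = 0 by have := svZ 0 0; rewrite rmorph0 !scale0r.
rewrite {2}(coord_vbasis (memvf u)) {2}(coord_vbasis (memvf v)).
rewrite (big_morph su suD su0) (big_morph sv svD sv0).
pose fl w : {linear U -> tensor U V} :=
  HB.pack ((@tens k U V)^~ w) (GRing.isLinear.Build _ _ _ _ _ (tl w)).
pose fr w : {linear V -> tensor U V} :=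
  HB.pack (@tens k U V w) (GRing.isLinear.Build _ _ _ _ _ (tr w)).
set x := \sum_(i < _) _; set y := \sum_(i < _) _.
rewrite -[x ⊗ y]/(fl y x) linear_sum; apply: eq_bigr => i _.
rewrite suZ linearZ /= -[_ ⊗ y]/(fr _ y) linear_sum scaler_sumr.
by apply: eq_bigr => j _; rewrite svZ linearZ /= mxE rmorphM scalerA.
Qed.

End TensorMaps.

Section TensorAlgebra.
Variables (k : fieldType) (A B : falgType k).
Implicit Types t s r : tensor A B.

Definition tmul t s : tensor A B :=
  tlift (fun a b => tlift (fun c d => (a * c) ⊗ (b * d)) s) t.

Definition tone : tensor A B := 1 ⊗ 1.

Let tl := (tens_bilin A B).1.
Let tr := (tens_bilin A B).2.

Fact tmul_linearl s : linear (tmul^~ s).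
Proof. by move=> a x y; rewrite /tmul linearP. Qed.

Fact tmul_linearr t : linear (tmul t).
Proof.
by move=> a x y; apply: tlift_comb => b c; rewrite linearP.
Qed.

Lemma tmul_tens a b c d : tmul (a ⊗ b) (c ⊗ d) = (a * c) ⊗ (b * d).
Proof.
have bil (x : A) (y : B) : bilin (fun (c : A) (d : B) => (x * c) ⊗ (y * d)).
  by split=> [z|z] e u v /=; rewrite mulrDr -scalerAr (tl, tr).
rewrite /tmul tlift_tens; first by rewrite tlift_tens.
split=> [z|z] e u v; apply: tlift_comb => x y;
  by rewrite mulrDl -scalerAl (tl, tr).
Qed.

Let tmulDl : left_distributive tmul +%R.
Proof.
by move=> t s r; have := tmul_linearl r 1 t s; rewrite !scale1r.
Qed.

Let tmulDr : right_distributive tmul +%R.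
Proof.
by move=> r t s; have := tmul_linearr r 1 t s; rewrite !scale1r.
Qed.

Let tmulA : associative tmul.
Proof.
elim/tens_ind=> [a b|t t' IHt IHt'] s r; last by rewrite !tmulDl IHt IHt'.
elim/tens_ind: s => [c d|s s' IHs IHs'].
  elim/tens_ind: r => [e f|r r' IHr IHr']; first by rewrite !tmul_tens !mulrA.
  by rewrite !tmulDr IHr IHr'.
by rewrite tmulDl !tmulDr tmulDl IHs IHs'.
Qed.

Let tmul1l : left_id tone tmul.
Proof.
elim/tens_ind=> [a b|t s IHt IHs]; last by rewrite tmulDr IHt IHs.
by rewrite tmul_tens !mul1r.
Qed.

Let tmul1r : right_id tone tmul.
Proof.
elim/tens_ind=> [a b|t s IHt IHs]; last by rewrite tmulDl IHt IHs.
by rewrite tmul_tens !mulr1.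
Qed.

Let tone_neq0 : tone != 0.
Proof.
have neq0 (C : falgType k) : exists i, coord (vbasis {:C}) i 1 != 0.
  apply/existsP; apply: contraTT (oner_neq0 C); rewrite negb_exists negbK.
  move/forallP=> c0; rewrite [1](coord_vbasis (memvf _)) big1 // => i _.
  by have := c0 i; rewrite negbK => /eqP->; rewrite scale0r.
have [[i ni] [j nj]] := (neq0 A, neq0 B).
by apply/eqP => /matrixP/(_ i j)/eqP; rewrite !mxE mulf_eq0 (negPf ni) (negPf nj).
Qed.

Let tmulZl (a : k) t s : a *: tmul t s = tmul (a *: t) s.
Proof. by rewrite /tmul linearZ. Qed.

Let tmulZr (a : k) t s : a *: tmul t s = tmul t (a *: s).
Proof.
have t0 : tmul t 0 = 0.
  rewrite /tmul {1}/tlift big1 // => i _; rewrite big1 // => j _.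
  by rewrite linear0 scaler0.
by have := tmul_linearr t a s 0; rewrite t0 !addr0.
Qed.

HB.instance Definition _ := GRing.Zmodule_isNzRing.Build (tensor A B)
  tmulA tmul1l tmul1r tmulDl tmulDr tone_neq0.
HB.instance Definition _ :=
  GRing.Lmodule_isLalgebra.Build k (tensor A B) tmulZl.
HB.instance Definition _ :=
  GRing.Lalgebra_isAlgebra.Build k (tensor A B) tmulZr.
HB.instance Definition _ := Algebra_isFalgebra.Build k (tensor A B).

Lemma mul_tens (a c : A) (b d : B) : (a ⊗ b) * (c ⊗ d) = (a * c) ⊗ (b * d).
Proof. exact: tmul_tens. Qed.

Lemma one_tens : 1 = 1 ⊗ 1 :> tensor A B.
Proof. by []. Qed.

End TensorAlgebra.

HB.mixin Record isCoalgebra (k : fieldType) C of Vector k C := {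
  comul : {linear C -> tensor C C};
  counit : {scalar C};
  comulA : forall h : C,
    tassoc (tmap comul idfun (comul h)) = tmap idfun comul (comul h);
  counitl : forall h : C, tlift (fun a b => counit a *: b) (comul h) = h;
  counitr : forall h : C, tlift (fun a b => counit b *: a) (comul h) = h }.

#[short(type="coalgType")]
HB.structure Definition Coalgebra (k : fieldType) :=
  { C of isCoalgebra k C & Vector k C }.

HB.mixin Record isBialgebra (k : fieldType) B
    of Coalgebra k B & Falgebra k B := {
  comul_monoid_morphism : monoid_morphism (comul : B -> tensor B B);
  counit_monoid_morphism : monoid_morphism (counit : B -> k) }.

#[short(type="bialgType")]
HB.structure Definition Bialgebra (k : fieldType) :=
  { B of isBialgebra k B & Coalgebra k B & Falgebra k B }.

HB.mixin Record isHopfAlgebra (k : fieldType) H of Bialgebra k H := {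
  antipode : {linear H -> H};
  antipodel : forall h : H,
    tlift (fun a b => antipode a * b) (comul h) = counit h *: (1 : H);
  antipoder : forall h : H,
    tlift (fun a b => a * antipode b) (comul h) = counit h *: (1 : H) }.

#[short(type="hopfAlgType")]
HB.structure Definition HopfAlgebra (k : fieldType) :=
  { H of isHopfAlgebra k H & Bialgebra k H }.

(* The converse ring A^c of an algebra A is the opposite algebra, on the same *)
(* vector space; for a bialgebra it carries the same coalgebra structure. An *)
(* antipode of H^c would be the inverse of that of H; Hopf powers and         *)
(* isomorphisms only involve the bialgebra structure.                         *)
HB.instance Definition _ (k : fieldType) (V : vectType k) :=
  Vector.copy V^c V.
HB.instance Definition _ (k : fieldType) (C : coalgType k) :=
  Coalgebra.copy C^c C.

Section OppositeAlgebra.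
Variables (k : fieldType) (A : falgType k).

Let cscaleAl (a : k) (x y : A^c) : a *: (x * y) = (a *: x : A^c) * y.
Proof. exact: (@scalerAr k A a y x). Qed.

Let cscaleAr (a : k) (x y : A^c) : a *: (x * y) = x * (a *: y : A^c).
Proof. exact: (@scalerAl k A a y x). Qed.

HB.instance Definition _ := GRing.Lmodule_isLalgebra.Build k A^c cscaleAl.
HB.instance Definition _ := GRing.Lalgebra_isAlgebra.Build k A^c cscaleAr.
HB.instance Definition _ := Falgebra.on A^c.

End OppositeAlgebra.

Section OppositeBialgebra.
Variables (k : fieldType) (B : bialgType k).

Let tensor_mulc (t s : tensor B B) :
  (t : tensor B^c B^c) * (s : tensor B^c B^c) = s * t.
Proof.
elim/tens_ind: t => [a b|t t' IHt IHt']; last first.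
  by rewrite mulrDr -IHt -IHt'; exact: (@mulrDl (tensor B^c B^c)).
elim/tens_ind: s => [c d|s s' IHs IHs']; last first.
  by rewrite mulrDl -IHs -IHs'; exact: (@mulrDr (tensor B^c B^c)).
by rewrite [RHS]mul_tens; exact: (@mul_tens k B^c B^c).
Qed.

Let comulc : monoid_morphism (comul : B^c -> tensor B^c B^c).
Proof.
have [c1 cM] := @comul_monoid_morphism k B.
by split=> [|x y]; [exact: c1 | rewrite tensor_mulc; exact: (cM y x)].
Qed.

Let counitc : monoid_morphism (counit : B^c -> k).
Proof.
have [c1 cM] := @counit_monoid_morphism k B.
by split=> [|x y]; [exact: c1 | rewrite [RHS]mulrC; exact: (cM y x)].
Qed.

HB.instance Definition _ := isBialgebra.Build k B^c comulc counitc.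

End OppositeBialgebra.

Section HopfPowers.
Variables (k : fieldType) (B : bialgType k).

Definition conv (f g : B -> B) (h : B) : B :=
  tlift (fun a b => f a * g b) (comul h).

Definition unit_counit (h : B) : B := counit h *: (1 : B).

(* The zeroth convolution power is the convolution unit. *)
Fixpoint hopf_power (n : nat) : B -> B :=
  if n is n'.+1 then conv (hopf_power n') id else unit_counit.

Definition trivial_power (n : nat) (h : B) : bool :=
  hopf_power n h == unit_counit h.

Definition is_exponent (e : nat) : Prop :=
  [/\ (0 < e)%N, forall h, trivial_power e h
    & forall n, (0 < n)%N -> (forall h, trivial_power n h) -> (e <= n)%N].

Fact unit_counit_is_linear : linear unit_counit.
Proof. by move=> a x y; rewrite /unit_counit linearP scalerDl scalerA. Qed.

HB.instance Definition _ :=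
  GRing.isLinear.Build k B B _ unit_counit unit_counit_is_linear.

Fact hopf_power_is_linear n : linear (hopf_power n).
Proof. by case: n => [|n] a x y /=; rewrite /conv !linearP. Qed.

HB.instance Definition _ n :=
  GRing.isLinear.Build k B B _ (hopf_power n) (hopf_power_is_linear n).

Definition Tn (n : nat) : {vspace B} :=
  lker (linfun (hopf_power n) - linfun unit_counit).

Lemma mem_Tn n h : (h \in Tn n) = trivial_power n h.
Proof. by rewrite memv_ker add_lfunE opp_lfunE !lfunE /= subr_eq0. Qed.

Definition tn (n : nat) : nat := \dim (Tn n).
Definition tmn (m n : nat) : nat := \dim (Tn m :&: Tn n)%VS.

End HopfPowers.

Arguments is_exponent {k} B e.
Arguments Tn {k} B n.
Arguments tn {k} B n.
Arguments tmn {k} B m n.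

(* Between Hopf algebras, a bialgebra isomorphism preserves the antipodes, so *)
(* this is isomorphism of Hopf algebras.                                     *)
Definition bialg_isomorphic (k : fieldType) (A B : bialgType k) : Prop :=
  exists f : {lrmorphism A -> B},
    [/\ bijective f, forall h, comul (f h) = tmap f f (comul h)
      & forall h, counit (f h) = counit h].

(* The involution bar of k may be the identity. star 1 = 1 follows from starM *)
(* and starK.                                                                *)
Record is_star_hopf (k : fieldType) (bar : {rmorphism k -> k})
    (H : hopfAlgType k) (star : H -> H) : Prop := {
  barK : involutive bar;
  starD : {morph star : x y / x + y};
  starZ : forall (a : k) (x : H), star (a *: x) = bar a *: star x;
  starM : forall x y : H, star (x * y) = star y * star x;
  starK : involutive star;
  star_comul : forall h : H, comul (star h) = tstar bar star star (comul h);
  star_counit : forall h : H, counit (star h) = bar (counit h) }.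

(* Main.v *)
Require Import Defs.
From mathcomp Require Import all_boot all_order all_algebra all_field.
From HB Require Import structures.
Import GRing.Theory.
Local Open Scope ring_scope.
Set Implicit Arguments.
Unset Strict Implicit.
Unset Printing Implicit Defensive.

(** Write P for the identity of H and S for the antipode, seen as elements of
the convolution algebra of linear maps H -> H. The n-th Hopf power is P ^ n,
and S is the inverse of P there. The exponent e gives P ^ e = 1, hence
P ^ n = S ^ (e - n) for n <= e (conv_id_exp_antipode).

Since S reverses products, S ^ m (h) = S(h_1) ... S(h_m) is S applied to
h_m ... h_1, the m-th Hopf power of h in the opposite algebra
(antipode_hopf_power_op). If S is injective, the m-th power of h in the
opposite algebra is therefore trivial exactly when S ^ m (h) is, that is, for
m = e - n, exactly when h^[n] is trivial: this is (1). For (2), P ^ n = 1 and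
S ^ n = 1 are equivalent because P and S are inverse to each other.

Injectivity of S comes from the exponent itself: for m = e - 1 the formula
above reads S(h_{e-1} ... h_1) = P(h) = h, so S has a right inverse, and a
surjective endomorphism of a finite-dimensional space is injective
(antipode_inj).

An involution of H exchanges Hopf powers in H and in the opposite algebra
(star_hopf_power); an isomorphism from H to its opposite sends Hopf powers in H
to those in the opposite algebra (morph_hopf_power). With (1), either of them is
a semilinear bijection that sends T_n into T_{e-n} for every n at once. This
gives (3), and the dimension inequalities behind (4); as n |-> e - n is an
involution, these inequalities are equalities. *)

(** * Computing with maps out of a tensor product *)

Section Sweedler.
Variable k : fieldType.

Lemma eq_tlift (U V : vectType k) (W : lmodType k) (B B' : U -> V -> W) t :
  (forall u v, B u v = B' u v) -> tlift B t = tlift B' t.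
Proof. by move=> BE; do 2![apply: eq_bigr => ? _]; rewrite BE. Qed.

Lemma linear_tlift (U V : vectType k) (W W' : lmodType k)
    (f : {linear W -> W'}) (B : U -> V -> W) t :
  f (tlift B t) = tlift (fun u v => f (B u v)) t.
Proof.
rewrite linear_sum; apply: eq_bigr => i _.
by rewrite linear_sum; apply: eq_bigr => j _; rewrite linearZ.
Qed.

Lemma scale_tlift (U V : vectType k) (W : lmodType k) (a : k)
    (B : U -> V -> W) t :
  a *: tlift B t = tlift (fun u v => a *: B u v) t.
Proof.
rewrite scaler_sumr; apply: eq_bigr => i _; rewrite scaler_sumr.
by apply: eq_bigr => j _; rewrite !scalerA mulrC.
Qed.

Lemma mulr_tlift (U V : vectType k) (A : falgType k) (x : A)
    (B : U -> V -> A) t :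
  x * tlift B t = tlift (fun u v => x * B u v) t.
Proof.
rewrite mulr_sumr; apply: eq_bigr => i _.
by rewrite mulr_sumr; apply: eq_bigr => j _; rewrite scalerAr.
Qed.

Lemma tlift_mulr (U V : vectType k) (A : falgType k) (x : A)
    (B : U -> V -> A) t :
  tlift B t * x = tlift (fun u v => B u v * x) t.
Proof.
rewrite mulr_suml; apply: eq_bigr => i _.
by rewrite mulr_suml; apply: eq_bigr => j _; rewrite scalerAl.
Qed.

Lemma tlift_tmap (U V U' V' : vectType k) (W : lmodType k)
    (B : U' -> V' -> W) (f : U -> U') (g : V -> V') t :
  bilin B -> tlift B (tmap f g t) = tlift (fun u v => B (f u) (g v)) t.
Proof.
move=> Bb; rewrite /tmap (linear_tlift (tlift B)).
by apply: eq_tlift => u v; rewrite /= tlift_tens.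
Qed.

Lemma tlift_mul (A A' : falgType k) (W : lmodType k) (B : A -> A' -> W)
    (t s : tensor A A') :
  bilin B ->
  tlift B (t * s) =
  tlift (fun a b => tlift (fun c d => B (a * c) (b * d)) s) t.
Proof.
move=> Bb; rewrite -[t * s]/(tmul t s) /tmul (linear_tlift (tlift B)).
apply: eq_tlift => a b /=; rewrite (linear_tlift (tlift B)).
by apply: eq_tlift => c d /=; rewrite tlift_tens.
Qed.

(** Coassociativity in the form used in Sweedler computations: the two ways of
splitting h in three agree inside every trilinear expression. *)
Lemma tlift_comul_assoc (C : coalgType k) (W : lmodType k)
    (T : C -> C -> C -> W) (h : C) :
  (forall a, bilin (T a)) -> (forall a b, linear (fun x => T x a b)) ->
  tlift (fun a c => tlift (fun a1 a2 => T a1 a2 c) (comul a)) (comul h) =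
  tlift (fun a c => tlift (fun c1 c2 => T a c1 c2) (comul c)) (comul h).
Proof.
move=> Tb Tl.
pose F a (bc : tensor C C) := tlift (T a) bc.
have Fb : bilin F.
  split=> [bc | a] x y z; last by rewrite /F linearP.
  by apply: tlift_comb => b c; rewrite Tl.
transitivity (tlift F (tassoc (tmap comul idfun (comul h)))).
  rewrite /tassoc (linear_tlift (tlift F)) tlift_tmap.
    apply: eq_tlift => a c /=; rewrite (linear_tlift (tlift F)).
    by apply: eq_tlift => a1 a2 /=; rewrite tlift_tens // /F tlift_tens.
  split=> [c | ab] x y z /=; first by rewrite !linearP.
  rewrite -linearP; congr (tlift _ _).
  apply: tlift_comb => u v.
  by rewrite (tens_bilin _ _).2 (tens_bilin _ _).2.
by rewrite comulA tlift_tmap.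
Qed.

End Sweedler.

(** * The convolution algebra *)

(** A named copy of the space of linear maps, so that its product is
convolution. The source is a bialgebra because a nontrivial unit requires a
nonzero counit, and the counit of a bialgebra maps 1 to 1. *)
Definition conv_alg (k : fieldType) (C : bialgType k) (A : falgType k) : Type :=
  'Hom(C, A).

Section ConvAlg.
Variables (k : fieldType) (C : bialgType k) (A : falgType k).
Local Notation R := (conv_alg C A).

HB.instance Definition _ := Vector.on R.

Definition conv_fun (f : R) : C -> A := fun_of_lfun (f : 'Hom(C, A)).
Coercion conv_fun : conv_alg >-> Funclass.

Definition conv_mul_fun (f g : R) (h : C) : A :=
  tlift (fun a b => f a * g b) (comul h).

Fact conv_mul_fun_linear f g : linear (conv_mul_fun f g).
Proof. by move=> a x y; rewrite /conv_mul_fun !linearP. Qed.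

HB.instance Definition _ f g :=
  GRing.isLinear.Build k C A _ (conv_mul_fun f g) (conv_mul_fun_linear f g).

Definition conv_one_fun (h : C) : A := counit h *: 1.

Fact conv_one_fun_linear : linear conv_one_fun.
Proof. by move=> a x y; rewrite /conv_one_fun linearP scalerDl scalerA. Qed.

HB.instance Definition _ :=
  GRing.isLinear.Build k C A _ conv_one_fun conv_one_fun_linear.

Definition conv_mul (f g : R) : R := linfun (conv_mul_fun f g).
Definition conv_one : R := linfun conv_one_fun.

Lemma conv_ext (f g : R) : (forall h, f h = g h) -> f = g.
Proof. by move=> fg; apply/(@lfunP k C A). Qed.

Fact conv_fun_linear (f : R) : linear (conv_fun f).
Proof. by move=> a x y; rewrite /conv_fun linearP. Qed.

HB.instance Definition _ f :=
  GRing.isLinear.Build k C A _ (conv_fun f) (conv_fun_linear f).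

Lemma conv_mulE f g h : conv_mul f g h = tlift (fun a b => f a * g b) (comul h).
Proof. by rewrite /conv_fun lfunE. Qed.

Lemma conv_oneE h : conv_one h = counit h *: 1.
Proof. by rewrite /conv_fun lfunE. Qed.

Lemma conv_addE (f g : R) h : conv_fun (f + g) h = f h + g h.
Proof. by rewrite /conv_fun add_lfunE. Qed.

Lemma conv_scaleE a (f : R) h : conv_fun (a *: f) h = a *: f h.
Proof. by rewrite /conv_fun scale_lfunE. Qed.

Let conv_mulA : associative conv_mul.
Proof.
move=> f g l; apply: conv_ext => h; rewrite !conv_mulE.
transitivity (tlift (fun a c => tlift (fun c1 c2 => f a * g c1 * l c2)
    (comul c)) (comul h)).
  apply: eq_tlift => a c; rewrite conv_mulE mulr_tlift.
  by apply: eq_tlift => c1 c2; rewrite mulrA.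
rewrite -(tlift_comul_assoc (T := fun a b c => f a * g b * l c)).
- by apply: eq_tlift => a c; rewrite conv_mulE tlift_mulr.
- move=> a; split=> b x y z; rewrite linearP mulrDr -scalerAr //.
  by rewrite mulrDl -scalerAl.
by move=> a b x y z; rewrite linearP !mulrDl -!scalerAl.
Qed.

Let conv_mul1r : left_id conv_one conv_mul.
Proof.
move=> f; apply: conv_ext => h; rewrite conv_mulE -{2}[h]counitl linear_tlift.
by apply: eq_tlift => a b; rewrite conv_oneE linearZ /= -scalerAl mul1r.
Qed.

Let conv_mulr1 : right_id conv_one conv_mul.
Proof.
move=> f; apply: conv_ext => h; rewrite conv_mulE -{2}[h]counitr linear_tlift.
by apply: eq_tlift => a b; rewrite conv_oneE linearZ /= -scalerAr mulr1.
Qed.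

Let conv_mulPl g : linear (conv_mul^~ g).
Proof.
move=> a x y; apply: conv_ext => h.
rewrite conv_addE conv_scaleE !conv_mulE; apply: tlift_comb => b c.
by rewrite conv_addE conv_scaleE mulrDl scalerAl.
Qed.

Let conv_mulPr g : linear (conv_mul g).
Proof.
move=> a x y; apply: conv_ext => h.
rewrite conv_addE conv_scaleE !conv_mulE; apply: tlift_comb => b c.
by rewrite conv_addE conv_scaleE mulrDr scalerAr.
Qed.

Let conv_mulDl : left_distributive conv_mul +%R.
Proof. by move=> f g l; have := conv_mulPl l 1 f g; rewrite !scale1r. Qed.

Let conv_mulDr : right_distributive conv_mul +%R.
Proof. by move=> l f g; have := conv_mulPr l 1 f g; rewrite !scale1r. Qed.

Let conv_one_neq0 : conv_one != 0.
Proof.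
apply: contraNneq (oner_neq0 A) => /(congr1 (@^~ (1 : C) \o conv_fun)) /=.
rewrite conv_oneE counit_monoid_morphism.1 scale1r => ->.
by rewrite /conv_fun zero_lfunE.
Qed.

HB.instance Definition _ := GRing.Zmodule_isNzRing.Build R
  conv_mulA conv_mul1r conv_mulr1 conv_mulDl conv_mulDr conv_one_neq0.

Let conv_scaleAl (a : k) (f g : R) : a *: (f * g) = (a *: f) * g.
Proof.
have m0 : conv_mul 0 g = 0 := mul0r g.
by have := conv_mulPl g a f 0; rewrite m0 !addr0.
Qed.

Let conv_scaleAr (a : k) (f g : R) : a *: (f * g) = f * (a *: g).
Proof.
have m0 : conv_mul f 0 = 0 := mulr0 f.
by have := conv_mulPr f a g 0; rewrite m0 !addr0.
Qed.

HB.instance Definition _ := GRing.Lmodule_isLalgebra.Build k R conv_scaleAl.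
HB.instance Definition _ := GRing.Lalgebra_isAlgebra.Build k R conv_scaleAr.
HB.instance Definition _ := Algebra_isFalgebra.Build k R.

Lemma convM (f g : R) h :
  conv_fun (f * g) h = tlift (fun a b => f a * g b) (comul h).
Proof. exact: conv_mulE. Qed.

Lemma conv1 h : conv_fun (1 : R) h = counit h *: 1.
Proof. exact: conv_oneE. Qed.

Lemma conv_linfunE (f : C -> A) h :
  linear f -> conv_fun (linfun f : R) h = f h.
Proof.
move=> fl; pose F : {linear C -> A} :=
  HB.pack f (GRing.isLinear.Build _ _ _ _ _ fl).
exact: (lfunE F).
Qed.

Definition conv_eval (h : C) (f : R) : A := f h.

Fact conv_eval_linear h : linear (conv_eval h).
Proof. by move=> a f g; rewrite /conv_eval conv_addE conv_scaleE. Qed.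

HB.instance Definition _ h :=
  GRing.isLinear.Build k R A _ (conv_eval h) (conv_eval_linear h).

End ConvAlg.

(** * Bilinear maps as elements of an iterated convolution algebra *)

Section Curry.
Variables (k : fieldType) (C D : bialgType k) (A : falgType k).

(** The convolution algebra of bilinear maps C x D -> A, which are the linear
maps from the coalgebra C ⊗ D to A, is obtained by iterating conv_alg. This
makes associativity for two variables a case of that for one. *)
Definition conv_curry (B : C -> D -> A) : conv_alg C (conv_alg D A) :=
  linfun (fun x => linfun (B x) : conv_alg D A).

Lemma conv_curryE (B : C -> D -> A) x y :
  bilin B -> conv_fun (conv_fun (conv_curry B) x) y = B x y.
Proof.
case=> Bl Br; rewrite conv_linfunE; first exact: conv_linfunE.
move=> a u v; apply: conv_ext => z.
by rewrite conv_addE conv_scaleE !conv_linfunE // Bl.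
Qed.

Lemma conv_curryM (B B' : C -> D -> A) x y :
  bilin B -> bilin B' ->
  conv_fun (conv_fun (conv_curry B * conv_curry B') x) y =
  tlift (fun a b => tlift (fun c d => B a c * B' b d) (comul y)) (comul x).
Proof.
move=> Bb Bb'; rewrite convM -[LHS]/(conv_eval y _) linear_tlift.
apply: eq_tlift => a b; rewrite /= /conv_eval convM.
by apply: eq_tlift => c d; rewrite !conv_curryE.
Qed.

End Curry.

(** * The antipode as a convolution inverse *)

Section Antipode.
Variables (k : fieldType) (H : hopfAlgType k).
Local Notation R := (conv_alg H H).
Local Notation S := (antipode : H -> H).

Definition conv_id : R := linfun (idfun : H -> H).
Definition conv_antipode : R := linfun S.

Lemma conv_idE h : conv_id h = h.
Proof. by rewrite conv_linfunE. Qed.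

Lemma conv_antipodeE h : conv_antipode h = S h.
Proof. by rewrite conv_linfunE // => a x y; rewrite linearP. Qed.

Lemma mul_antipode_id : conv_antipode * conv_id = 1.
Proof.
apply: conv_ext => h; rewrite convM conv1 -antipodel.
by apply: eq_tlift => a b; rewrite conv_idE conv_antipodeE.
Qed.

Lemma hopf_power_conv n h : hopf_power n h = (conv_id ^+ n : R) h.
Proof.
elim: n h => [|n IHn] h; first by rewrite conv1.
rewrite exprSr convM; apply: eq_tlift => a b.
by rewrite conv_idE -IHn.
Qed.

(** In the convolution algebra of bilinear maps H x H -> H, the product mu has
the left inverse rho(x, y) = S(x * y) and the right inverse
nu(x, y) = S(y) * S(x), so these two agree. *)
Lemma antipodeM (x y : H) : S (x * y) = S y * S x.
Proof.
have bM : bilin (fun x y : H => x * y).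
  by split=> z a u v /=; rewrite (mulrDl, mulrDr) -(scalerAl, scalerAr).
have bSM : bilin (fun x y : H => S (x * y)).
  by split=> z a u v /=; rewrite (bM.1, bM.2) linearP.
have bMS : bilin (fun x y : H => S y * S x).
  by split=> z a u v /=; rewrite linearP (bM.1, bM.2).
pose rho := conv_curry (fun x y : H => S (x * y)).
pose mu := conv_curry (fun x y : H => x * y).
pose nu := conv_curry (fun x y : H => S y * S x).
have oneE u v : conv_fun (conv_fun (1 : conv_alg H R) u) v =
    counit u *: (counit v *: 1).
  by rewrite conv1 conv_scaleE conv1.
have rho_mu : rho * mu = 1.
  apply: conv_ext => u; apply: conv_ext => v.
  rewrite conv_curryM // oneE scalerA -(counit_monoid_morphism).2 -antipodel.
  rewrite (comul_monoid_morphism).2 tlift_mul //.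
  by split=> z a b c /=; rewrite ?linearP (bM.1, bM.2).
have mu_nu : mu * nu = 1.
  apply: conv_ext => u; apply: conv_ext => v.
  rewrite conv_curryM // oneE scalerA mulrC -scalerA -antipoder.
  rewrite scale_tlift; apply: eq_tlift => a b.
  transitivity (a * tlift (fun c d => c * S d) (comul v) * S b).
    by rewrite mulr_tlift tlift_mulr; apply: eq_tlift => c d; rewrite !mulrA.
  by rewrite antipoder -scalerAr mulr1 scalerAl.
have: rho = nu by rewrite -[rho]mulr1 -mu_nu mulrA rho_mu mul1r.
by move/(congr1 (fun f => conv_fun (conv_fun f x) y)); rewrite !conv_curryE.
Qed.

End Antipode.

(** * Hopf powers in the opposite algebra *)

Section OppositePowers.
Variables (k : fieldType) (H : hopfAlgType k).
Local Notation R := (conv_alg H H).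
Local Notation S := (antipode : H -> H).
Local Notation P := (conv_id H).
Local Notation Q := (conv_antipode H).

Lemma antipode1 : S 1 = 1.
Proof.
have := antipodel (1 : H); rewrite (comul_monoid_morphism).1 one_tens.
rewrite tlift_tens; last first.
  split=> z a u v /=; last by rewrite mulrDr -scalerAr.
  by rewrite linearP mulrDl -scalerAl.
by rewrite mulr1 (counit_monoid_morphism).1 scale1r.
Qed.

(** Here S only has to reverse products, S(h_n ... h_1) = S(h_1) ... S(h_n): the
coproduct of h is the same in both algebras. *)
Lemma antipode_hopf_power_op n (h : H) :
  S (hopf_power (B := H^c) n h) = conv_fun (Q ^+ n) h.
Proof.
elim: n h => [|n IHn] h.
  by rewrite conv1 /= /unit_counit linearZ /= antipode1.
rewrite exprSr convM /= linear_tlift; apply: eq_tlift => a b /=.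
by rewrite [LHS]antipodeM conv_antipodeE -IHn.
Qed.

Lemma mul_exp_linv (A : pzRingType) (p q : A) n :
  q * p = 1 -> q ^+ n * p ^+ n = 1.
Proof.
move=> qp; elim: n => [|n IHn]; first by rewrite mulr1.
by rewrite exprSr exprS mulrA -(mulrA _ q) qp mulr1.
Qed.

Variables (e : nat) (He : forall h : H, trivial_power e h).

Lemma conv_id_exp : P ^+ e = 1.
Proof.
by apply: conv_ext => h; rewrite -hopf_power_conv conv1; exact/eqP/He.
Qed.

Lemma conv_id_exp_antipode n : (n <= e)%N -> P ^+ n = Q ^+ (e - n).
Proof.
move=> len; rewrite -[LHS]mul1r -(mul_exp_linv (e - n) (mul_antipode_id H)).
by rewrite -mulrA -exprD subnK // conv_id_exp mulr1.
Qed.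

Hypothesis e_gt0 : (0 < e)%N.

(** Here the exponent replaces the general theorem that the antipode of a
finite-dimensional Hopf algebra is bijective: S ^ (e - 1) = P provides a right
inverse of S, namely the Hopf power e - 1 of the opposite algebra. *)
Lemma antipode_inj : injective S.
Proof.
pose f : 'End(H) := linfun (hopf_power (B := H^c) (e - 1)).
pose s : 'End(H) := linfun antipode.
have fE h : f h = hopf_power (B := H^c) (e - 1) h.
  exact: (lfunE (hopf_power (B := H^c) (e - 1) : {linear H^c -> H^c})).
have sf : (s \o f = \1)%VF.
  apply/lfunP => h; rewrite comp_lfunE fE !lfunE /= antipode_hopf_power_op.
  by rewrite -conv_id_exp_antipode // expr1 conv_idE.
have fker : lker f == 0%VS.
  apply/lker0P => x y fxy.
  by rewrite -[x](id_lfunE x) -[y](id_lfunE y) -sf !comp_lfunE fxy.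
have fs : (f \o s = \1)%VF.
  by rewrite -[s](lker0_compfK fker) sf comp_lfun1l lker0_compfV.
apply: (can_inj (g := f)) => x.
by have /lfunP/(_ x) := fs; rewrite comp_lfunE !lfunE.
Qed.

Lemma trivial_power_conv n (h : H) :
  trivial_power n h = (conv_fun (P ^+ n) h == conv_fun 1 h).
Proof. by rewrite /trivial_power hopf_power_conv conv1. Qed.

Lemma trivial_power_op n (h : H) :
  trivial_power (B := H^c) n h = (conv_fun (Q ^+ n) h == conv_fun 1 h).
Proof.
rewrite -[conv_fun 1 h]/(conv_fun (Q ^+ 0) h) -!antipode_hopf_power_op.
by rewrite (inj_eq antipode_inj).
Qed.

(** The power e - n of h in the opposite algebra is trivial exactly when h^[n]
is, because S sends the former to the latter, is injective and fixes 1. *)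
Lemma Tn_op n : (n <= e)%N -> Tn H n = Tn H^c (e - n) :> {vspace H}.
Proof.
move=> len; apply/vspaceP => h; rewrite mem_Tn [RHS](@mem_Tn k H^c).
by rewrite trivial_power_conv trivial_power_op conv_id_exp_antipode.
Qed.

(** P ^ n and Q ^ n are inverse to each other, so one is the unit as soon as the
other is. *)
Lemma all_trivial_power_op n :
  (forall h : H, trivial_power (B := H^c) n h) <->
  (forall h : H, trivial_power n h).
Proof.
split=> triv h.
  have Qn : Q ^+ n = 1.
    by apply: conv_ext => x; apply/eqP; rewrite -trivial_power_op.
  rewrite trivial_power_conv -(mul_exp_linv n (mul_antipode_id H)).
  by rewrite Qn mul1r.
have Pn : P ^+ n = 1.
  by apply: conv_ext => x; apply/eqP; rewrite -trivial_power_conv.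
rewrite trivial_power_op -(mul_exp_linv n (mul_antipode_id H)).
by rewrite Pn mulr1.
Qed.

End OppositePowers.

(** * Transport under involutions and isomorphisms *)

Section Transport.
Variables (k : fieldType).

(** For t = comul h this compares B(star h_1, star h_2) with phi (B'(h_1, h_2)):
both sides are semilinear with respect to bar, so that agreement on pure tensors
is enough. *)
Lemma tlift_tstar (bar : k -> k) (U V : vectType k) (W : lmodType k)
    (su : U -> U) (sv : V -> V) (B : U -> V -> W) (phi : W -> W)
    (B' : U -> V -> W) t :
  {morph phi : x y / x + y} -> (forall a x, phi (a *: x) = bar a *: phi x) ->
  bilin B -> (forall u v, B (su u) (sv v) = phi (B' u v)) ->
  tlift B (tstar bar su sv t) = phi (tlift B' t).
Proof.
move=> phiD phiZ Bb BB'.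
have phi0 : phi 0 = 0 by apply: (addIr (phi 0)); rewrite -phiD !add0r.
rewrite /tstar (big_morph phi phiD phi0) linear_sum; apply: eq_bigr => i _.
rewrite (big_morph phi phiD phi0) linear_sum; apply: eq_bigr => j _.
by rewrite linearZ /= tlift_tens // BB' phiZ.
Qed.

(** The section bar' lifts the coefficients of a relation among the images of a
basis, which gives a relation among the basis vectors. *)
Lemma leq_dim_semilinear (U V : vectType k) (bar bar' : k -> k)
    (phi : U -> V) (X : {vspace U}) (Y : {vspace V}) :
  cancel bar' bar -> bar 0 = 0 ->
  {morph phi : x y / x + y} -> (forall a x, phi (a *: x) = bar a *: phi x) ->
  injective phi -> (forall x, x \in X -> phi x \in Y) ->
  (\dim X <= \dim Y)%N.
Proof.
move=> barK bar0 phiD phiZ phi_inj XY.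
have phi0 : phi 0 = 0 by apply: (addIr (phi 0)); rewrite -phiD !add0r.
pose b := [tuple of map phi (vbasis X)].
have b_free : free b.
  apply/freeP => c sum0 i; rewrite -[c i]barK -bar0; congr bar.
  have /freeP/(_ (bar' \o c)) := basis_free (vbasisP X); apply=> {i}.
  apply: phi_inj; rewrite phi0 -sum0 (big_morph phi phiD phi0).
  apply: eq_bigr => i _; rewrite phiZ /= barK.
  by rewrite (nth_map 0) ?size_tuple.
rewrite -[\dim X](size_tuple b) -(eqP b_free); apply/dimvS/span_subvP => y.
by case/mapP=> x xX ->; apply/XY/vbasis_mem.
Qed.

(** An involution reverses products but keeps the order of the tensor factors
in a coproduct: star h_1 ... star h_n = star (h_n ... h_1). *)
Lemma star_hopf_power (H : hopfAlgType k) (bar : {rmorphism k -> k})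
    (star : H -> H) n (h : H) :
  is_star_hopf bar star ->
  hopf_power n (star h) = star (hopf_power (B := H^c) n h).
Proof.
case=> _ sD sZ sM sK sC se.
have s1 : star 1 = 1 by have := sM (star 1) 1; rewrite mulr1 sK mulr1.
elim: n h => [|n IHn] h; first by rewrite /= /unit_counit se sZ s1.
rewrite /= /conv sC.
apply: (tlift_tstar (bar := bar)) => // [|a b]; last by rewrite IHn -sM.
by split=> z a u v; rewrite ?linearP (mulrDl, mulrDr) -(scalerAl, scalerAr).
Qed.

Lemma morph_hopf_power (A B : bialgType k) (f : {lrmorphism A -> B}) n h :
  (forall h, comul (f h) = tmap f f (comul h)) ->
  (forall h, counit (f h) = counit h) ->
  f (hopf_power n h) = hopf_power n (f h).
Proof.
move=> fC fe; elim: n h => [|n IHn] h.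
  by rewrite /= /unit_counit linearZ /= rmorph1 fe.
rewrite /= /conv linear_tlift fC tlift_tmap; last first.
  by split=> z a u v; rewrite ?linearP (mulrDl, mulrDr) -(scalerAl, scalerAr).
by apply: eq_tlift => a b; rewrite rmorphM -IHn.
Qed.

End Transport.

Theorem proposition2p2 (k : fieldType) (H : hopfAlgType k) (e : nat)
    (exp_H : is_exponent H e) :
  [/\ forall n : nat, (1 <= n < e)%N ->
        Tn H n = Tn H^c (e - n) :> {vspace H},
      is_exponent H^c e,
      forall (bar : {rmorphism k -> k}) (star : H -> H),
        is_star_hopf bar star ->
        forall n : nat, (1 <= n < e)%N ->
        forall h : H,
          h \in Tn H (e - n) <-> exists2 g : H, g \in Tn H n & h = star g
    & (exists (bar : {rmorphism k -> k}) (star : H -> H),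
         is_star_hopf bar star)
      \/ bialg_isomorphic H H^c ->
        (forall n : nat, (1 <= n < e)%N -> tn H n = tn H (e - n)) /\
        (forall m n : nat, (1 <= m < e)%N -> (1 <= n < e)%N ->
           tmn H m n = tmn H (e - m) (e - n))].
Proof.
have [e_gt0 He e_min] := exp_H.
have opTn n : (n <= e)%N -> Tn H n = Tn H^c (e - n) :> {vspace H}.
  exact: Tn_op.
have triv_op := all_trivial_power_op He e_gt0.
have star_Tn bar star : is_star_hopf bar star ->
    forall n, (n <= e)%N ->
    forall g, (star g \in Tn H (e - n)) = (g \in Tn H n).
  move=> sH n len g; rewrite (opTn n) // mem_Tn [RHS](@mem_Tn k H^c).
  rewrite /trivial_power (star_hopf_power _ _ sH).
  (* The convolution unit is the zeroth Hopf power. *)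
  have -> : unit_counit (star g) = star (unit_counit g).
    exact: (star_hopf_power 0 g sH).
  exact/inj_eq/inv_inj/(starK sH).
split.
- by move=> n /andP[_ /ltnW]; apply: opTn.
- split=> // [|n n0 tn]; first exact/triv_op.
  by apply: e_min n0 _; apply/triv_op.
- move=> bar star sH n /andP[_ /ltnW len] h; split=> [hT|[g gT ->]].
    exists (star h); last by rewrite (starK sH).
    by rewrite -(star_Tn bar star sH n len) (starK sH).
  by rewrite (star_Tn bar star sH).
move=> sym.
(* Both alternatives provide one map phi, independent of n, which is semilinear
   for the involution of k in the first case and linear in the second. *)
have [bar [bar' [phi [barK bar0 phiD phiZ [phi_inj phiT]]]]] :
    exists (bar bar' : k -> k) (phi : H -> H),
    [/\ cancel bar' bar, bar 0 = 0, {morph phi : x y / x + y},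
      forall a x, phi (a *: x) = bar a *: phi x
      & injective phi /\ forall n, (n <= e)%N ->
          forall x, x \in Tn H n -> phi x \in Tn H (e - n)].
  case: sym => [[bar [star sH]]|[f [f_bij fC fe]]].
    exists bar, bar, star; split; [exact: barK sH | exact: rmorph0
      | exact: starD sH | exact: starZ sH | split].
      exact/inv_inj/(starK sH).
    by move=> n len x; rewrite (star_Tn bar star sH).
  exists id, id, f.
  split=> //; [exact: (raddfD f) | exact: (linearZZ f) | split].
    exact: bij_inj.
  move=> n len x xT.
  rewrite (opTn (e - n)%N) ?leq_subr // subKn // [_ \in _](@mem_Tn k H^c).
  move: xT; rewrite mem_Tn /trivial_power => /eqP xT.
  rewrite -(morph_hopf_power n x fC fe) xT.
  by rewrite -[unit_counit x]/(hopf_power 0 x) (morph_hopf_power 0 x fC fe).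
have le_t n : (n <= e)%N -> (tn H n <= tn H (e - n))%N.
  move=> len; apply: (leq_dim_semilinear barK bar0 phiD phiZ phi_inj) => x.
  exact: phiT.
have le_tm m n : (m <= e)%N -> (n <= e)%N ->
    (tmn H m n <= tmn H (e - m) (e - n))%N.
  move=> lem len; apply: (leq_dim_semilinear barK bar0 phiD phiZ phi_inj) => x.
  by rewrite !memv_cap => /andP[xm xn]; rewrite !phiT.
split=> [n /andP[_ /ltnW len] | m n /andP[_ /ltnW lem] /andP[_ /ltnW len]].
  apply/eqP; rewrite eqn_leq le_t //=.
  by rewrite -{2}(subKn len) le_t ?leq_subr.
apply/eqP; rewrite eqn_leq le_tm //=.
by rewrite -{2}(subKn len) -{2}(subKn lem) le_tm ?leq_subr.
Qed.
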